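(* Let $(V,\mathcal{S})$ be a set system with $V=\{1,\dots,n\}$ in which every element lies in at most $t$ sets, and run the algorithm described in the context. Then with probability at least $1-O(n^{-2})$, after time $T$ there are no alive variables, i.e.\ $A_{T+1}=\emptyset$.
   Context: Algorithm. Parameters: $\gamma=1/(n^2\log n)$, $T=(12/\gamma^2)\log n$, $a=6$. Initialize $x_0=0\in\mathbb{R}^n$ and $A_1=V$ (the set of ''alive'' variables). For $k=1,2,\dots,T$: let $\mathcal{B}_k=\{S\in\mathcal{S}:|S\cap A_k|\ge at\}$ and $\mathcal{L}_k=\mathcal{S}\setminus\mathcal{B}_k$. Compute an optimal solution $(u_i^k)_{i\in A_k}$, $u_i^k\in\mathbb{R}^n$, of the semidefinite program: maximize $\sum_{i\in A_k}\|u_i\|_2^2$ subject to $\|\sum_{i\in S\cap A_k}u_i\|_2^2=0$ for each $S\in\mathcal{B}_k$; $\|\sum_{i\in S\cap A_k}u_i\|_2^2\le 2\sum_{i\in S\cap A_k}\|u_i\|_2^2$ for each $S\in\mathcal{L}_k$; $\|\sum_{i\in S\cap A_k}x_{k-1}(i)u_i\|_2^2\le 2\sum_{i\in S\cap A_k}\|u_i\|_2^2$ for each $S\in\mathcal{L}_k$; $\|u_i\|_2^2\le 1$ for each $i\in A_k$. Draw $r_k\in\{-1,1\}^n$ with independent uniformly random coordinates. Set $x_k(i)=x_{k-1}(i)+\gamma\langle r_k,u_i^k\rangle$ for $i\in A_k$ and $x_k(i)=x_{k-1}(i)$ otherwise. Set $A_{k+1}=A_k\setminus\{i:|x_k(i)|\ge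 1-1/n\}$. *)

(* Defs.v *)
From HB Require Import structures.
From mathcomp Require Import all_boot all_order all_algebra.
From mathcomp Require Import all_classical all_reals all_analysis.
Set Implicit Arguments.
Unset Strict Implicit.
Unset Printing Implicit Defensive.
Import Order.TTheory GRing.Theory Num.Theory.
Local Open Scope ring_scope.

(* [`|_|] on ['rV[R]_n] is the sup norm, so the Euclidean structure is
   defined here. *)
Definition dot (R : realType) (n : nat) (u v : 'rV[R]_n) : R :=
  \sum_(j < n) u 0 j * v 0 j.

Definition sqnorm (R : realType) (n : nat) (u : 'rV[R]_n) : R := dot u u.

Definition degree_le (n : nat) (F : {set {set 'I_n}}) (t : nat) : Prop :=
  forall i : 'I_n, (#|[set S in F | i \in S]| <= t)%N.

Definition gamma (R : realType) (n : nat) : R :=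
  (n%:R ^+ 2 * ln n%:R)^-1.

(* The loop index runs over the integers k with 1 <= k <= (12/gamma^2) log n,
   hence the integer part. *)
Definition horizon (R : realType) (n : nat) : nat :=
  Num.truncn (12 / gamma R n ^+ 2 * ln n%:R).

Definition a_param : nat := 6.

Definition big_sets (n : nat) (F : {set {set 'I_n}}) (t : nat)
    (A : {set 'I_n}) : {set {set 'I_n}} :=
  [set S in F | (a_param * t <= #|S :&: A|)%N].

Definition small_sets (n : nat) (F : {set {set 'I_n}}) (t : nat)
    (A : {set 'I_n}) : {set {set 'I_n}} :=
  F :\: big_sets F t A.

(* A candidate solution is indexed by all of ['I_n]; only its values on the
   alive set [A] are constrained or ever used. *)
Definition sdp_value (R : realType) (n : nat) (A : {set 'I_n})
    (u : 'I_n -> 'rV[R]_n) : R :=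
  \sum_(i in A) sqnorm (u i).

Definition sdp_feasible (R : realType) (n : nat) (F : {set {set 'I_n}})
    (t : nat) (A : {set 'I_n}) (x : 'rV[R]_n) (u : 'I_n -> 'rV[R]_n) : Prop :=
  [/\ forall S, S \in big_sets F t A ->
        sqnorm (\sum_(i in S :&: A) u i) = 0,
      forall S, S \in small_sets F t A ->
        sqnorm (\sum_(i in S :&: A) u i)
          <= 2 * \sum_(i in S :&: A) sqnorm (u i),
      forall S, S \in small_sets F t A ->
        sqnorm (\sum_(i in S :&: A) x 0 i *: u i)
          <= 2 * \sum_(i in S :&: A) sqnorm (u i) &
      forall i, i \in A -> sqnorm (u i) <= 1].

Definition sdp_optimal (R : realType) (n : nat) (F : {set {set 'I_n}})
    (t : nat) (A : {set 'I_n}) (x : 'rV[R]_n) (u : 'I_n -> 'rV[R]_n) : Prop :=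
  sdp_feasible F t A x u /\
  forall v, sdp_feasible F t A x v -> sdp_value A v <= sdp_value A u.

(* A point r of {-1,1}^n; [true] encodes -1. *)
Definition signs (n : nat) := {ffun 'I_n -> bool}.

Definition sign_vec (R : realType) (n : nat) (r : signs n) : 'rV[R]_n :=
  \row_j (-1) ^+ r j.

Record state (R : realType) (n : nat) := State {
  coloring : 'rV[R]_n;
  alive : {set 'I_n}
}.

Definition init (R : realType) (n : nat) : state R n := State 0 [set: 'I_n].

Definition next_coloring (R : realType) (n : nat) (s : state R n)
    (u : 'I_n -> 'rV[R]_n) (r : signs n) : 'rV[R]_n :=
  \row_i (if i \in alive s
          then coloring s 0 i + gamma R n * dot (sign_vec R r) (u i)
          else coloring s 0 i).

Definition step (R : realType) (n : nat) (s : state R n)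
    (u : 'I_n -> 'rV[R]_n) (r : signs n) : state R n :=
  let x := next_coloring s u r in
  State x (alive s :\: [set i : 'I_n | 1 - n%:R^-1 <= `|x 0 i|]).

(* Histories list the past draws with the MOST RECENT FIRST, so that
   [run sol [:: r_k; ...; r_1]] is the pair (x_k, A_(k+1)).  The solution used
   in round k is [sol [:: r_(k-1); ...; r_1]]: optimal solutions of the
   semidefinite program need not be unique, and the choice may depend on the
   whole past but not on the current or future draws. *)
Definition solver (R : realType) (n : nat) := seq (signs n) -> 'I_n -> 'rV[R]_n.

Fixpoint run (R : realType) (n : nat) (sol : solver R n) (h : seq (signs n)) :
    state R n :=
  if h is r :: h' then step (run sol h') (sol h') r else init R n.

Definition optimal_solver (R : realType) (n : nat) (F : {set {set 'I_n}})
    (t : nat) (sol : solver R n) : Prop :=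
  forall h : seq (signs n), (size h < horizon R n)%N ->
    sdp_optimal F t (alive (run sol h)) (coloring (run sol h)) (sol h).

Definition unif_prob (R : realType) (Omega : finType) (E : {set Omega}) : R :=
  #|E|%:R / #|Omega|%:R.

(* Independent uniform coordinates of r_1, ..., r_T amount to the uniform
   distribution on T-tuples of sign vectors. *)
Definition prob_none_alive (R : realType) (n : nat) (sol : solver R n) : R :=
  @unif_prob R ((horizon R n).-tuple (signs n))
    [set h : (horizon R n).-tuple (signs n) | alive (run sol h) == finset.set0].

(* Main.v *)
Require Import Defs.
From HB Require Import structures.
From mathcomp Require Import all_boot all_order all_algebra.
From mathcomp Require Import all_classical all_reals all_analysis.
From mathcomp Require Import ring lra zify.
Set Implicit Arguments.
Unset Strict Implicit.
Unset Printing Implicit Defensive.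
Import Order.TTheory GRing.Theory Num.Theory.
Local Open Scope ring_scope.

(** Every optimal solution of the semidefinite program has value at least a
    third of the number of alive variables.  By a minimax argument it suffices,
    for each choice of nonnegative multipliers of the constraints on the small
    sets, to find a positive semidefinite matrix meeting the remaining
    constraints and the weighted sum of these.  The quadratic form of that sum
    is at most twice a diagonal form on a subspace of codimension at most half
    the number of alive variables, because of a trace bound; the big sets cost
    at most another sixth, since degrees are at most [t].  The orthogonal
    projection onto the intersection works.

    Hence the sum of [1 - x_i^2] over alive [i] decreases in expectation by a
    factor [1 - gamma^2 / 3] per round, so it is at most [O(n^-3)] after
    [horizon] rounds, while an alive variable contributes at least [1 / n].
    Markov's inequality concludes.  Variables freeze with [x_i^2 <= 1] as soon
    as [ln n >= 1]; the other [n] are absorbed in the constant. *)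

(** * Euclidean geometry of row vectors and finite orthonormal families *)

Section Orthonormal.
Variables (R : realType) (n : nat).
Implicit Types (u v w z : 'rV[R]_n) (s : seq 'rV[R]_n).

Lemma dotC u v : dot u v = dot v u.
Proof. by apply: eq_bigr => i _; rewrite mulrC. Qed.

Lemma dotDl u v w : dot (u + v) w = dot u w + dot v w.
Proof. by rewrite /dot -big_split; apply: eq_bigr => i _; rewrite mxE mulrDl. Qed.

Lemma dotZl a u v : dot (a *: u) v = a * dot u v.
Proof. by rewrite /dot mulr_sumr; apply: eq_bigr => i _; rewrite mxE mulrA. Qed.

Lemma dot0l u : dot 0 u = 0.
Proof. by rewrite -(scale0r (0 : 'rV_n)) dotZl mul0r. Qed.

Lemma dotBl u v w : dot (u - v) w = dot u w - dot v w.
Proof. by rewrite -scaleN1r dotDl dotZl mulN1r. Qed.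

Lemma sqnormE u : sqnorm u = \sum_i u 0 i ^+ 2.
Proof. by apply: eq_bigr => i _; rewrite expr2. Qed.

Lemma sqnorm_ge0 u : 0 <= sqnorm u.
Proof. by rewrite sqnormE; apply: sumr_ge0 => i _; exact: sqr_ge0. Qed.

Lemma sqnorm_gt0 u : u != 0 -> 0 < sqnorm u.
Proof.
move=> u0; rewrite lt_def sqnorm_ge0 andbT; apply: contra_neq u0.
rewrite sqnormE => /eqP; rewrite psumr_eq0 => [|i _]; last exact: sqr_ge0.
move=> /allP u0; apply/rowP => i; rewrite mxE; apply/eqP.
by rewrite -sqrf_eq0; apply: u0; rewrite mem_index_enum.
Qed.

Lemma sqnormZ a u : sqnorm (a *: u) = a ^+ 2 * sqnorm u.
Proof. by rewrite /sqnorm dotZl dotC dotZl mulrA expr2. Qed.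

Lemma dot_delta u i : dot u (delta_mx 0 i) = u 0 i.
Proof.
rewrite /dot (bigD1 i) //= mxE !eqxx mulr1 big1 ?addr0 // => j ji.
by rewrite mxE eqxx (negPf ji) mulr0.
Qed.

Lemma exists_normalizer u : u != 0 ->
  exists2 a, a != 0 & sqnorm (a *: u) = 1.
Proof.
move=> /sqnorm_gt0 u0; exists (Num.sqrt (sqnorm u))^-1.
  by rewrite invr_eq0 gt_eqF // sqrtr_gt0.
by rewrite sqnormZ exprVn sqr_sqrtr ?sqnorm_ge0 // mulVf // gt_eqF.
Qed.

(** The matrix with columns [s] has more rows than columns, so its left kernel is nonzero. *)
Lemma exists_orthogonal s : (size s < n)%N ->
  exists2 v, v != 0 & forall w, w \in s -> dot v w = 0.
Proof.
move=> sn.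
pose A : 'M[R]_(n, size s) := \matrix_(i, k) (nth 0 s k) 0 i.
have : kermx A != 0.
  rewrite kermx_eq0 /row_free; apply: contraL sn => /eqP rA.
  by rewrite -leqNgt; have := rank_leq_col A; rewrite rA.
case/rowV0Pn => v /sub_kermxP vA v0; exists v => // w ws.
have iw : (index w s < size s)%N by rewrite index_mem.
have := congr1 (fun B : 'rV_(size s) => B 0 (Ordinal iw)) vA.
rewrite !mxE => <-; apply: eq_bigr => i _.
by rewrite mxE nth_index.
Qed.

Fixpoint orthonormal s : Prop :=
  if s is w :: s' then
    [/\ sqnorm w = 1, forall x, x \in s' -> dot w x = 0 & orthonormal s']
  else True.

Lemma orthonormal_unit s w : orthonormal s -> w \in s -> sqnorm w = 1.
Proof.
by elim: s => //= x s IH [x1 _ os]; rewrite inE => /predU1P[->//|]; exact: IH.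
Qed.

(** Removing from [z] its component along the head [w] leaves the products with the tail
    unchanged. *)
Lemma bessel s z : orthonormal s -> \sum_(w <- s) dot z w ^+ 2 <= sqnorm z.
Proof.
elim: s z => [|w s IH] z /=; first by rewrite big_nil sqnorm_ge0.
move=> [w1 ws os]; rewrite big_cons -lerBrDl.
pose z' := z - dot z w *: w.
have -> : sqnorm z - dot z w ^+ 2 = sqnorm z'.
  have -> : sqnorm z' = dot z z' - dot z w * dot w z'.
    by rewrite /sqnorm {1}/z' dotBl dotZl.
  rewrite !(dotC _ z') /z' !dotBl !dotZl -/(sqnorm z) -/(sqnorm w) w1 (dotC w z).
  ring.
apply: le_trans (IH z' os); rewrite big_seq [leRHS]big_seq.
by apply: ler_sum => x xs; rewrite dotBl dotZl ws // mulr0 subr0.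
Qed.

Lemma bessel_coord s i : orthonormal s -> \sum_(w <- s) w 0 i ^+ 2 <= 1.
Proof.
move=> os; apply: le_trans (_ : sqnorm (delta_mx 0 i : 'rV[R]_n) <= 1).
  by apply: le_trans (bessel _ os); under eq_bigr do rewrite -dot_delta dotC.
by rewrite /sqnorm dot_delta mxE !eqxx.
Qed.

(** The trace of the orthogonal projection onto the span of [s] is its rank. *)
Lemma sum_sqnorm_orthonormal s : orthonormal s ->
  \sum_i \sum_(w <- s) w 0 i ^+ 2 = (size s)%:R.
Proof.
move=> os; rewrite exchange_big /= big_seq.
under eq_bigr => w ws do rewrite -sqnormE (orthonormal_unit os ws).
by rewrite -big_seq big_const_seq count_predT iter_addr addr0.
Qed.

Lemma orthonormal_size s : orthonormal s -> (size s <= n)%N.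
Proof.
move=> os; rewrite -(ler_nat R) -(sum_sqnorm_orthonormal os).
apply: le_trans (_ : \sum_(i < n) 1 <= _).
  by apply: ler_sum => i _; exact: bessel_coord.
by rewrite sumr_const card_ord.
Qed.

(** Sizes of orthonormal families are bounded by [n], so a largest one within [Q] exists, and
    prepending a vector would contradict its size. *)
Lemma maximal_orthonormal (Q : 'rV[R]_n -> Prop) :
  exists s, [/\ orthonormal s, forall w, w \in s -> Q w &
    forall w, sqnorm w = 1 -> (forall x, x \in s -> dot w x = 0) -> ~ Q w].
Proof.
pose P k := `[< exists s, [/\ size s = k, orthonormal s &
                           forall w, w \in s -> Q w] >].
have P0 : exists k, P k by exists 0%N; apply/asboolP; exists [::].
have Pn k : P k -> (k <= n)%N.
  by move=> /asboolP[s [<- os _]]; exact: orthonormal_size.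
case: (ex_maxnP P0 Pn) => k /asboolP[s [sk os Qs]] kmax; exists s; split => //.
move=> w w1 ws Qw; have : P k.+1.
  apply/asboolP; exists (w :: s); split => //=; first by rewrite sk.
  by move=> x; rewrite inE => /predU1P[->//|]; exact: Qs.
by move/kmax; rewrite ltnn.
Qed.

End Orthonormal.

(** * Orthonormal families adapted to fixed multipliers *)

Section DualFamily.
Variables (R : realType) (n : nat) (A : {set 'I_n}).
Implicit Types (b w : 'rV[R]_n) (s cs : seq 'rV[R]_n).

(** If [s] were shorter, then [s], [cs] and the basis vectors outside [A] would number fewer than
    [n], and a unit vector orthogonal to all of them would extend [s]. *)
Lemma orthonormal_complement cs : exists s,
  [/\ orthonormal s, forall w, w \in s -> forall i, i \notin A -> w 0 i = 0,
      forall w, w \in s -> forall c, c \in cs -> dot w c = 0 &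
      (#|A| <= size s + size cs)%N].
Proof.
have [s [os Qs smax]] := maximal_orthonormal (fun w =>
  (forall i, i \notin A -> w 0 i = 0) /\ forall c, c \in cs -> dot w c = 0).
exists s; split => // [w /Qs[]//|w /Qs[]//|]; rewrite leqNgt; apply/negP => lt.
pose ds : seq 'rV[R]_n := [seq delta_mx 0 i | i in ~: A].
have : (size (s ++ cs ++ ds) < n)%N.
  rewrite !size_cat /ds size_image addnA.
  by rewrite -[ltnRHS]card_ord -(cardsC A) ltn_add2r.
case/exists_orthogonal => v v0 vo.
have [a _ av1] := exists_normalizer v0.
apply: (smax (a *: v)) => // [x xs|].
  by rewrite dotZl vo ?mulr0 // mem_cat xs.
split=> [i iA|c cs']; last by rewrite dotZl vo ?mulr0 // !mem_cat cs' orbT.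
rewrite mxE -dot_delta vo ?mulr0 // !mem_cat; apply/orP; right; apply/orP; right.
by apply/mapP; exists i => //; rewrite mem_enum inE.
Qed.

(* A maximal family, orthonormal for the weighted inner product, of vectors on
   which the form exceeds twice the weighted norm: by Bessel it has at most
   #|A| / 2 elements, and by maximality the form is at most twice the weighted
   norm on its orthogonal complement. *)
Lemma few_large_directions (J : finType) (v : J -> 'rV[R]_n) (lam : J -> R)
    (d : 'I_n -> R) :
  (forall j, 0 <= lam j) -> (forall i, 0 < d i) ->
  (forall i, \sum_j lam j * v j 0 i ^+ 2 <= d i) ->
  exists cs, (2 * size cs <= #|A|)%N /\
    forall b, (forall i, i \notin A -> b 0 i = 0) ->
      (forall c, c \in cs -> dot b c = 0) ->
      \sum_j lam j * dot (v j) b ^+ 2 <= 2 * \sum_i d i * b 0 i ^+ 2.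
Proof.
move=> lam0 d0 vd; pose sg i := Num.sqrt (d i).
have sg0 i : sg i != 0 by rewrite gt_eqF // sqrtr_gt0.
have sg2 i : sg i ^+ 2 = d i by rewrite sqr_sqrtr // ltW.
(* Scaling coordinates by [sg] makes the weighted norm Euclidean; [z j] represents pairing with
   [v j] in the scaled coordinates, on vectors supported in [A]. *)
pose z j : 'rV[R]_n := \row_i (if i \in A then v j 0 i / sg i else 0).
have zE j w : (forall i, i \notin A -> w 0 i = 0) ->
    dot (z j) w = dot (v j) (\row_i (w 0 i / sg i)).
  move=> wA; apply: eq_bigr => i _; rewrite !mxE.
  by case: ifPn => [_|/wA ->]; [rewrite mulrAC mulrA | rewrite !mul0r mulr0].
have [s [os Qs smax]] := maximal_orthonormal (fun w =>
  (forall i, i \notin A -> w 0 i = 0) /\ 2 < \sum_j lam j * dot (z j) w ^+ 2).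
pose scl w : 'rV[R]_n := \row_i (sg i * w 0 i).
exists [seq scl w | w <- s]; split=> [|b bA bs].
  rewrite size_map -(ler_nat R) natrM.
  have -> : 2 * (size s)%:R = \sum_(w <- s) 2 :> R.
    by rewrite big_const_seq count_predT iter_addr addr0 mulr_natr.
  apply: (@le_trans _ _ (\sum_(w <- s) \sum_j lam j * dot (z j) w ^+ 2)).
    rewrite big_seq [leRHS]big_seq; apply: ler_sum => w /Qs[_].
    exact: ltW.
  rewrite exchange_big /=.
  apply: (@le_trans _ _ (\sum_j lam j * sqnorm (z j))).
    apply: ler_sum => j _; rewrite -mulr_sumr.
    by apply: ler_wpM2l => //; exact: bessel.
  under eq_bigr do rewrite sqnormE mulr_sumr.
  rewrite exchange_big /= -sum1_card natr_sum big_mkcond [leRHS]big_mkcond /=.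
  apply: ler_sum => i _; case: ifPn => iA; last first.
    by rewrite big1 // => j _; rewrite mxE (negPf iA) expr0n mulr0.
  under eq_bigr do rewrite mxE iA expr_div_n sg2 mulrA.
  by rewrite -mulr_suml ler_pdivrMr // mul1r.
have zb j : dot (z j) (scl b) = dot (v j) b.
  rewrite zE => [|i iA]; last by rewrite mxE bA // mulr0.
  congr dot; apply/rowP => i.
  by rewrite !mxE mulrAC divff // mul1r.
have nb : sqnorm (scl b) = \sum_i d i * b 0 i ^+ 2.
  by rewrite sqnormE; apply: eq_bigr => i _; rewrite mxE exprMn sg2.
under eq_bigr do rewrite -zb.
rewrite -nb; have [->|w0] := eqVneq (scl b) 0.
  rewrite big1 => [|j _]; first by rewrite mulr_ge0 ?sqnorm_ge0.
  by rewrite dotC dot0l expr0n mulr0.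
have [a a0 a1] := exists_normalizer w0.
have /(smax _ a1) nQ : forall x, x \in s -> dot (a *: scl b) x = 0.
  move=> x xs; rewrite dotZl -[dot _ _](_ : dot b (scl x) = _).
    by rewrite bs ?mulr0 //; apply: map_f.
  by apply: eq_bigr => i _; rewrite !mxE mulrCA mulrA.
rewrite leNgt; apply/negP => lt; apply: nQ; split.
  by move=> i iA; rewrite !mxE bA // !mulr0.
have -> : \sum_j lam j * dot (z j) (a *: scl b) ^+ 2 =
          a ^+ 2 * \sum_j lam j * dot (z j) (scl b) ^+ 2.
  rewrite mulr_sumr; apply: eq_bigr => j _.
  by rewrite dotC dotZl dotC exprMn mulrCA.
move: a1; rewrite sqnormZ => a1.
have a20 : 0 < a ^+ 2 by rewrite exprn_even_gt0.
have : a ^+ 2 * (2 * sqnorm (scl b)) < a ^+ 2 * \sum_j lam j * dot (z j) (scl b) ^+ 2.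
  by rewrite ltr_pM2l.
by rewrite mulrCA a1 mulr1.
Qed.

(** Dimension count: at most half of [#|A|] is lost to the large directions and a sixth to [bs],
    leaving a third for [s]. *)
Lemma dual_family (J : finType) (v e : J -> 'rV[R]_n) (lam : J -> R) (eps : R)
    (bs : seq 'rV[R]_n) :
  (forall j i, v j 0 i ^+ 2 <= e j 0 i) -> (forall j, 0 <= lam j) -> 0 < eps ->
  (6 * size bs <= #|A|)%N ->
  exists s, [/\ orthonormal s,
    forall w, w \in s -> forall i, i \notin A -> w 0 i = 0,
    forall w, w \in s -> forall b, b \in bs -> dot w b = 0,
    (#|A| <= 3 * size s)%N &
    \sum_j lam j * \sum_(w <- s)
      (dot (v j) w ^+ 2 - 2 * \sum_i e j 0 i * w 0 i ^+ 2) <= eps].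
Proof.
(* Adding [del] makes the weights [d] positive. As [s] has at most [n] unit vectors, this costs at
   most [2 * del * n <= eps]; the [+ 1] covers [n = 0]. *)
move=> ve lam0 eps0 bsA; pose del := eps / (2 * n%:R + 1).
have n0 : 0 < 2 * n%:R + 1 :> R by rewrite ltr_wpDl // mulr_ge0.
have del0 : 0 < del by rewrite divr_gt0.
pose d i := \sum_j lam j * e j 0 i + del.
have e0 j i : 0 <= e j 0 i by apply: le_trans (ve j i); exact: sqr_ge0.
have [|i|i|cs [csA csP]] := @few_large_directions J v lam d.
- by [].
- by rewrite ltr_wpDl // sumr_ge0 // => j _; rewrite mulr_ge0.
- apply: ler_wpDr; first exact: ltW.
  by apply: ler_sum => j _; rewrite ler_wpM2l.
have [s [os sA scb sz]] := orthonormal_complement (cs ++ bs).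
exists s; split => //.
- by move=> w ws b bbs; apply: scb => //; rewrite mem_cat bbs orbT.
- by move: sz; rewrite size_cat; lia.
apply: (@le_trans _ _ (\sum_(w <- s) 2 * del * sqnorm w)); last first.
  rewrite -mulr_sumr; under eq_bigr do rewrite sqnormE.
  rewrite exchange_big /= sum_sqnorm_orthonormal //.
  have sn : (size s)%:R <= n%:R :> R by rewrite ler_nat orthonormal_size.
  have -> : eps = del * (2 * n%:R + 1) by rewrite mulfVK // gt_eqF.
  rewrite mulrAC mulrC ler_pM2l //; lra.
under eq_bigr do rewrite mulr_sumr.
rewrite exchange_big /= big_seq [leRHS]big_seq; apply: ler_sum => w ws.
have H : \sum_j lam j * dot (v j) w ^+ 2 <= 2 * \sum_i d i * w 0 i ^+ 2.
  by apply: csP => [|c ccs]; [exact: sA | apply: scb; rewrite ?mem_cat ?ccs].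
have dE : \sum_i d i * w 0 i ^+ 2 =
    \sum_j lam j * (\sum_i e j 0 i * w 0 i ^+ 2) + del * sqnorm w.
  under [in RHS]eq_bigr do rewrite mulr_sumr.
  rewrite exchange_big /= sqnormE mulr_sumr -big_split /=.
  apply: eq_bigr => i _; rewrite mulrDl mulr_suml; congr (_ + _).
  by apply: eq_bigr => j _; rewrite mulrA.
have -> : \sum_j lam j * (dot (v j) w ^+ 2 - 2 * \sum_i e j 0 i * w 0 i ^+ 2) =
    \sum_j lam j * dot (v j) w ^+ 2 -
    2 * \sum_j lam j * (\sum_i e j 0 i * w 0 i ^+ 2).
  by rewrite mulr_sumr -sumrB; apply: eq_bigr => j _; rewrite mulrBr (mulrCA 2).
by move: H; rewrite dE mulrDr -lerBlDl mulrA.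
Qed.

End DualFamily.

(** * Minimax over a compact convex set *)

Section Minimax.
Variables (R : realType) (N : nat).
Import numFieldNormedType.Exports.
Local Open Scope classical_set_scope.

Lemma dot_continuous (c : 'rV[R]_N) : continuous (dot c).
Proof.
have -> : dot c = \sum_i (fun x : 'rV[R]_N => c 0 i * x 0 i).
  by apply/funext => x; rewrite fct_sumE.
apply: (big_ind (fun f : 'rV[R]_N -> R => continuous f)) => [|f h cf ch|i _].
- exact: cst_continuous.
- by move=> x; apply: continuousD; [exact: cf | exact: ch].
- by move=> x; apply: continuousM; [exact: cst_continuous | exact: coord_continuous].
Qed.

(* Minimise [f x = \sum_j (max (g_j x) 0)^2] over the compact convex set; at a
   minimiser with [f x > 0], moving towards the [y] provided by the weights
   [max (g_j x) 0] decreases [f] to first order. *)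
Lemma halfspaces_minimax (J : finType) (D : 'rV[R]_N -> R -> Prop)
    (g : J -> 'rV[R]_N) :
  let K (x : 'rV[R]_N) := (forall i, -1 <= x 0 i <= 1) /\ forall c h, D c h -> dot c x <= h in
  (forall (lam : J -> R) (eps : R), (forall j, 0 <= lam j) -> 0 < eps ->
     exists2 y, K y & \sum_j lam j * dot (g j) y <= eps) ->
  exists2 x, K x & forall j, dot (g j) x <= 0.
Proof.
move=> K HK.
pose pos (r : R) := Num.max r 0.
pose f x := \sum_j pos (dot (g j) x) ^+ 2.
have Kcompact : compact (K : set 'rV[R]_N).
  have -> : (K : set 'rV[R]_N) =
      [set x : 'rV[R]_N | forall i, `[-1, 1]%classic (x ord0 i)] `&`
      \bigcap_(p in [set p : 'rV[R]_N * R | D p.1 p.2])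
        (dot p.1 @^-1` [set r | r <= p.2]).
    apply/seteqP; split => x.
      move=> [xb xD]; split => [i /=|[c h] /= Dch]; last exact: xD.
      by rewrite in_itv /= xb.
    move=> [xb xD]; split => [i|c h Dch]; last exact: (xD (c, h)).
    by have := xb i; rewrite /= in_itv.
  apply: compact_closedI; first by
    apply: (@rV_compact R N (fun=> `[-1, 1]%classic)) => i; exact: segment_compact.
  apply: closed_bigI => p _.
  by have /continuous_closedP := @dot_continuous p.1; apply; exact: closed_le.
have fcont : continuous f.
  have -> : f = \sum_j (fun x => pos (dot (g j) x) ^+ 2).
    by apply/funext => x; rewrite fct_sumE.
  apply: (big_ind (fun f : 'rV[R]_N -> R => continuous f)) => [|f1 f2 c1 c2|j _].
  - exact: cst_continuous.
  - by move=> x; apply: continuousD; [exact: c1 | exact: c2].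
  have cp : continuous (fun x => pos (dot (g j) x)).
    apply: (@max_fun_continuous _ _ R (dot (g j)) (fun=> 0)).
      exact: dot_continuous.
    exact: cst_continuous.
  move=> x; apply: (@continuous_comp _ _ _ (fun x => pos (dot (g j) x))
    (fun r : R => r ^+ 2)); first exact: cp.
  exact: exprn_continuous.
have [|x] := compact_EVT_min _ Kcompact (continuous_subspaceT fcont).
  by have [//|//|y Ky _] := HK (fun=> 0) 1; exists y.
rewrite inE => Kx fmin; exists x => // j0; rewrite leNgt; apply/negP => gj0.
pose a j := dot (g j) x; pose p j := pos (a j).
have p0 j : 0 <= p j by rewrite /p /pos le_max lexx orbT.
have pa j : p j * a j = p j ^+ 2.
  by rewrite /p /pos; case: (leP (a j) 0); rewrite ?mul0r ?expr2 ?mulr0.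
have ap j : a j <= p j by rewrite /p /pos le_max lexx.
have s0 : 0 < f x.
  apply: (@lt_le_trans _ _ (p j0 ^+ 2)).
    by rewrite exprn_gt0 // (lt_le_trans gj0) // ap.
  by rewrite /f (bigD1 j0) //= ler_wpDr // sumr_ge0 // => j _; exact: sqr_ge0.
(* Slack [f x / 2] suffices: since [p j * a j = p j ^+ 2], the sum of [p j * c j] is then at most
   [f x / 2 - f x]. *)
have [//||y Ky Hy] := HK p (f x / 2); first by rewrite divr_gt0.
pose c j := dot (g j) y - a j; pose q := \sum_j c j ^+ 2.
have q0 : 0 <= q by apply: sumr_ge0 => j _; exact: sqr_ge0.
have sq0 : 0 < f x + q by rewrite ltr_pwDl.
(* For this [t] the first-order gain [t * f x] exceeds the second-order loss [t ^+ 2 * q], and [z]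
   stays between [x] and [y]. *)
pose t := f x / (f x + q).
have t0 : 0 < t by rewrite divr_gt0.
have t1 : t <= 1 by rewrite ler_pdivrMr // mul1r lerDl.
have tq : t * q < f x.
  by rewrite mulrAC ltr_pdivrMr // ltr_pM2l // ltrDr.
pose z := x + t *: (y - x).
have dz (e : 'rV[R]_N) : dot e z = dot e x + t * (dot e y - dot e x).
  by rewrite dotC dotDl dotZl dotBl !(dotC _ e).
have Kz : K z.
  split=> [i|e h De]; last first.
    have := Kx.2 _ _ De; have := Ky.2 _ _ De; rewrite dz; nra.
  have /andP[x1 x2] := Kx.1 i; have /andP[y1 y2] := Ky.1 i.
  rewrite !mxE; apply/andP; split; nra.
have := fmin z; rewrite inE => /(_ Kz); apply/negP; rewrite -ltNge.
apply: (@le_lt_trans _ _ (\sum_j (p j + t * c j) ^+ 2)).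
  apply: ler_sum => j _; rewrite dz -/(a j) -/(c j) /pos.
  case: (leP (a j + t * c j) 0) => h; first by rewrite expr0n sqr_ge0.
  rewrite ler_sqr ?nnegrE ?lerD2r ?ap ?(ltW h) //.
  by apply: le_trans (ltW h) _; rewrite lerD2r ap.
have -> : \sum_j (p j + t * c j) ^+ 2 =
    f x + 2 * t * (\sum_j p j * c j) + t ^+ 2 * q.
  rewrite /f /q !mulr_sumr -!big_split /=; apply: eq_bigr => j _.
  rewrite -/(a j) -/(p j); ring.
have pc : \sum_j p j * c j <= - (f x / 2).
  rewrite /c; under eq_bigr do rewrite mulrBr pa.
  rewrite sumrB -/(f x); lra.
have : t * (\sum_j p j * c j) <= t * - (f x / 2) by rewrite ler_pM2l.
have : t * (t * q) < t * f x by rewrite ltr_pM2l.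
move: (\sum_j _) => u; nra.
Qed.

End Minimax.

(** * Positive semidefinite matrices as Gram matrices *)

Section Gram.
Variables (R : realType) (n : nat).
Implicit Types (X C : 'M[R]_n) (v w : 'rV[R]_n).

Definition qform X v : R := dot (v *m X) v.

Lemma qformE X v : qform X v = \sum_i \sum_k v 0 i * v 0 k * X i k.
Proof.
rewrite exchange_big; apply: eq_bigr => k _ /=.
by rewrite mxE mulr_suml; apply: eq_bigr => i _; rewrite mulrAC.
Qed.

Lemma qform_delta X i : qform X (delta_mx 0 i) = X i i.
Proof. by rewrite /qform dot_delta -rowE mxE. Qed.

(** Nonnegativity of this quadratic polynomial in [a] drives the Cholesky elimination. *)
Lemma qform_shift X v i a : (forall i k, X i k = X k i) ->
  qform X (v + a *: delta_mx 0 i) =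
  qform X v + 2 * a * dot v (row i X) + a ^+ 2 * X i i.
Proof.
move=> Xsym.
have vX : dot (v *m X) (delta_mx 0 i) = dot v (row i X).
  by rewrite dot_delta mxE; apply: eq_bigr => k _; rewrite mxE Xsym.
rewrite /qform mulmxDl -scalemxAl -rowE dotDl dotZl !(dotC _ (v + _)) !dotDl.
rewrite !dotZl !(dotC (delta_mx 0 i)) vX dot_delta mxE (dotC v (_ *m _)).
rewrite -/(qform X v); ring.
Qed.

(* Cholesky: subtract rank one matrices, killing one row at a time. *)
Lemma psd_gram X (B : {set 'I_n}) :
  (forall i k, X i k = X k i) -> (forall v, 0 <= qform X v) ->
  (forall i k, i \notin B -> X i k = 0) ->
  exists2 s : seq 'rV[R]_n, size s = #|B| &
    forall i k, X i k = \sum_(w <- s) w 0 i * w 0 k.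
Proof.
move: {2}#|B| (erefl #|B|) => m; elim: m X B => [|m IH] X B cB Xsym Xpsd XB.
  exists [::] => // i k; rewrite big_nil XB //.
  by move/eqP: cB; rewrite cards_eq0 => /eqP ->; rewrite inE.
have [a aB] : exists a, a \in B by apply/set0Pn; rewrite -card_gt0 cB.
have Xaa : 0 <= X a a by rewrite -qform_delta.
have Xa0 k : X a a = 0 -> X a k = 0.
  move=> X0; apply/eqP/negPn/negP => Xak.
  (* The coefficient is chosen to give the form the value [-1]. *)
  have := Xpsd (delta_mx 0 k + (- (X k k + 1) / (2 * X a k)) *: delta_mx 0 a).
  rewrite qform_shift // qform_delta X0 mulr0 addr0 dotC dot_delta mxE.
  have -> : 2 * (- (X k k + 1) / (2 * X a k)) * X a k = - (X k k + 1) by field.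
  lra.
(* If [X a a = 0], the inverse is [0] by convention and [w = 0]; row [a] of [X] vanishes already. *)
pose w : 'rV[R]_n := (Num.sqrt (X a a))^-1 *: row a X.
have wE i k : X a a * (w 0 i * w 0 k) = X a i * X a k.
  have [X0|X0] := eqVneq (X a a) 0; first by rewrite X0 mul0r Xa0 // mul0r.
  rewrite !mxE mulrACA -expr2 exprVn sqr_sqrtr //.
  by rewrite mulVKf.
have w0 i : X a i = 0 -> w 0 i = 0 by move=> Xi; rewrite !mxE Xi mulr0.
pose X' := X - w^T *m w.
have X'E i k : X' i k = X i k - w 0 i * w 0 k.
  by rewrite !mxE big_ord1 !mxE.
have qX' v : qform X' v = qform X v - dot v w ^+ 2.
  rewrite !qformE expr2 {2}/dot mulr_sumr -sumrB; apply: eq_bigr => i _.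
  rewrite mulrC mulr_sumr -sumrB; apply: eq_bigr => k _; rewrite X'E; ring.
have [|i k|v|i k iB|s ss sE] := IH X' (B :\ a).
- by move: cB; rewrite (cardsD1 a B) aB => -[].
- by rewrite !X'E Xsym [in RHS]mulrC.
- rewrite qX' subr_ge0.
  have [X0|X0] := eqVneq (X a a) 0.
    have -> : w = 0 by apply/rowP => i; rewrite [RHS]mxE; exact/w0/Xa0.
    by rewrite dotC dot0l expr0n Xpsd.
  (* This multiple minimises the form along [delta_mx 0 a]; the minimum is [qform X' v]. *)
  have := Xpsd (v + (- (dot v (row a X) / X a a)) *: delta_mx 0 a).
  rewrite qform_shift //.
  have -> : dot v w ^+ 2 = dot v (row a X) ^+ 2 / X a a.
    by rewrite dotC dotZl dotC exprMn exprVn sqr_sqrtr // mulrC.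
  rewrite -subr_ge0; set q := qform X v; set r := dot _ _.
  by have -> : q + 2 * - (r / X a a) * r + (- (r / X a a)) ^+ 2 * X a a =
    q - r ^+ 2 / X a a by field.
- rewrite X'E; move: iB; rewrite !inE negb_and negbK => /orP[/eqP ->|iB].
    have [X0|X0] := eqVneq (X a a) 0; first by rewrite (Xa0 _ X0) (w0 _ X0) mul0r subr0.
    by apply: (mulfI X0); rewrite mulrBr wE mulr0 subrr.
  have wi : w 0 i = 0 by apply: w0; rewrite Xsym XB.
  by rewrite XB // wi mul0r subr0.
exists (w :: s) => [|i k].
  by rewrite /= ss (cardsD1 a B) aB.
by rewrite big_cons -sE X'E addrC subrK.
Qed.

(** Elimination yields exactly [n] vectors, so their [i]-th coordinates form a vector of the
    dimension the program asks for. *)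
Lemma psd_gram_vectors X :
  (forall i k, X i k = X k i) -> (forall v, 0 <= qform X v) ->
  exists u : 'I_n -> 'rV[R]_n, forall i k, dot (u i) (u k) = X i k.
Proof.
move=> Xsym Xpsd; have [|s ss sE] := psd_gram (B := [set: 'I_n]) Xsym Xpsd.
  by move=> i k; rewrite inE.
exists (fun i => \row_(k < n) (nth 0 s k) 0 i) => i k.
rewrite sE (big_nth 0) ss cardsT card_ord big_mkord.
by apply: eq_bigr => l _; rewrite !mxE.
Qed.

(** Makes the constraints of the program linear in the Gram matrix. *)
Lemma sqnorm_sum X (u : 'I_n -> 'rV[R]_n) (P : pred 'I_n) (c : 'I_n -> R) :
  (forall i k, dot (u i) (u k) = X i k) ->
  sqnorm (\sum_(i | P i) c i *: u i) = qform X (\row_i (if P i then c i else 0)).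
Proof.
move=> uX; have -> : \sum_(i | P i) c i *: u i =
    \sum_i (if P i then c i else 0) *: u i.
  by rewrite big_mkcond; apply: eq_bigr => i _; case: ifP; rewrite ?scale0r.
have suml (I : finType) (d : I -> 'rV[R]_n) w :
    dot (\sum_i d i) w = \sum_i dot (d i) w.
  rewrite /dot exchange_big; apply: eq_bigr => l _.
  by rewrite summxE mulr_suml.
rewrite qformE /sqnorm suml; apply: eq_bigr => i _.
rewrite dotZl dotC suml mulr_sumr; apply: eq_bigr => k _.
by rewrite dotZl dotC uX !mxE mulrA.
Qed.

(** Flattening turns the Frobenius product into [dot], so that the minimax lemma for row vectors
    applies to matrices. *)
Lemma dot_mxvec C X : dot (mxvec C) (mxvec X) = \sum_i \sum_k C i k * X i k.
Proof.
rewrite pair_big /dot (reindex _ (curry_mxvec_bij n n)) /=.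
by apply: eq_bigr => -[i k] _; rewrite !mxvecE.
Qed.

Lemma dot_mxvec_delta X i k : dot (mxvec (delta_mx i k)) (mxvec X) = X i k.
Proof.
rewrite dot_mxvec (bigD1 i) //= (bigD1 k) //= mxE !eqxx mul1r.
rewrite !big1 ?addr0 // => [l li|l lk].
  by apply: big1 => m _; rewrite mxE (negPf li) mul0r.
by rewrite mxE (negPf lk) andbF mul0r.
Qed.

Lemma dot_mxvec_rank1 X v : dot (mxvec (v^T *m v)) (mxvec X) = qform X v.
Proof.
rewrite dot_mxvec qformE; apply: eq_bigr => i _; apply: eq_bigr => k _.
by rewrite mxE big_ord1 mxE.
Qed.

Lemma dot_mxvec_diag X v :
  dot (mxvec (diag_mx v)) (mxvec X) = \sum_i v 0 i * X i i.
Proof.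
rewrite dot_mxvec; apply: eq_bigr => i _; rewrite (bigD1 i) //= mxE eqxx mulr1n.
by rewrite big1 ?addr0 // => k ki; rewrite mxE eq_sym (negPf ki) mulr0n mul0r.
Qed.

End Gram.

(** * Lower bound on the value of the semidefinite program *)

Section SdpValue.
Variables (R : realType) (n : nat).

(** The program in Gram form: [v j] holds the coefficients of a norm constraint, [e j] the indicator
    on its right-hand side, and [bs] the indicators of big sets. *)
Lemma psd_solution (A : {set 'I_n}) (J : finType) (v e : J -> 'rV[R]_n)
    (bs : seq 'rV[R]_n) :
  (forall j i, v j 0 i ^+ 2 <= e j 0 i) -> (6 * size bs <= #|A|)%N ->
  exists X : 'M[R]_n, [/\ forall i k, X i k = X k i, forall w, 0 <= qform X w,
    forall i, X i i <= 1, forall b, b \in bs -> qform X b = 0 &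
    #|A|%:R / 3 <= \sum_(i in A) X i i /\
    forall j, qform X (v j) <= 2 * \sum_i e j 0 i * X i i].
Proof.
move=> ve bsA.
(* Half-spaces for symmetry, positivity (one for each [w]), big sets and trace. One inequality per
   big set is enough, positivity giving the other. *)
pose D (c : 'rV[R]_(n * n)) (h : R) :=
  [\/ exists i k, c = mxvec (delta_mx i k) - mxvec (delta_mx k i) /\ h = 0,
      exists w : 'rV[R]_n, c = - 1 *: mxvec (w^T *m w) /\ h = 0,
      exists b : 'rV[R]_n, [/\ b \in bs, c = mxvec (b^T *m b) & h = 0] |
      c = - 1 *: mxvec (diag_mx (\row_i (i \in A)%:R)) /\ h = - (#|A|%:R / 3)].
pose g j := mxvec ((v j)^T *m v j) - 2 *: mxvec (diag_mx (e j)).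
have gE X j : dot (g j) (mxvec X) = qform X (v j) - 2 * \sum_i e j 0 i * X i i.
  by rewrite dotBl dotZl dot_mxvec_rank1 dot_mxvec_diag.
have sumA (X : 'M[R]_n) :
    \sum_i (\row_i (i \in A)%:R : 'rV[R]_n) 0 i * X i i = \sum_(i in A) X i i.
  rewrite [RHS]big_mkcond; apply: eq_bigr => i _.
  by rewrite mxE; case: (i \in A); rewrite ?mul1r ?mul0r.
have [|x [xbox xD] xg] := @halfspaces_minimax R (n * n) J D g.
  move=> lam eps lam0 eps0.
  have [s [os sA sbs szs slam]] := dual_family ve lam0 eps0 bsA.
  (* The orthogonal projection onto the span of [s]: its diagonal is at most [1] by Bessel, and its
     trace is [size s]. *)
  pose Y : 'M[R]_n := \matrix_(i, k) \sum_(w <- s) w 0 i * w 0 k.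
  have qY c : qform Y c = \sum_(w <- s) dot c w ^+ 2.
    rewrite qformE.
    under eq_bigr => i _ do under eq_bigr => k _ do rewrite mxE mulr_sumr.
    under eq_bigr do rewrite exchange_big.
    rewrite exchange_big; apply: eq_bigr => w _ /=.
    rewrite expr2 {1}/dot mulr_suml; apply: eq_bigr => i _.
    rewrite /dot mulr_sumr; apply: eq_bigr => k _; ring.
  have Yd i : Y i i = \sum_(w <- s) w 0 i ^+ 2.
    by rewrite mxE; apply: eq_bigr => w _; rewrite expr2.
  have Yd1 i : Y i i <= 1 by rewrite Yd; exact: bessel_coord.
  have YA i : i \notin A -> Y i i = 0.
    by move=> iA; rewrite mxE big_seq big1 // => w ws; rewrite sA // mul0r.
  exists (mxvec Y); last first.
    rewrite (le_trans _ slam) // le_eqVlt; apply/orP; left; apply/eqP.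
    apply: eq_bigr => j _; rewrite gE qY sumrB; congr (_ * (_ - _)).
    rewrite -mulr_sumr exchange_big; congr (_ * _); apply: eq_bigr => i _ /=.
    by rewrite Yd mulr_sumr.
  split=> [l|c h].
    case/mxvec_indexP: l => i k; rewrite mxvecE.
    (* Taking [a = 1] and [a = -1] bounds off-diagonal entries by diagonal ones, which puts [Y] in
       the box. *)
    have ik a : a ^+ 2 = 1 -> 0 <= Y i i + Y k k + 2 * a * Y i k.
      move=> a1; rewrite !Yd mxE mulr_sumr -!big_split /=.
      apply: sumr_ge0 => w _; rewrite (_ : _ + _ = (w 0 i + a * w 0 k) ^+ 2).
        exact: sqr_ge0.
      by rewrite sqrrD exprMn a1; ring.
    have := ik 1 (expr1n _ _); have := ik (-1) (sqrr_sign R 1).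
    by have := Yd1 i; have := Yd1 k; rewrite mulr1 mulrN1; lra.
  case=> [[i [k [-> ->]]]|[w [-> ->]]|[b [bbs -> ->]]|[-> ->]].
  - rewrite dotBl !dot_mxvec_delta !mxE -sumrB big1 // => w _.
    by rewrite mulrC subrr.
  - rewrite dotZl dot_mxvec_rank1 qY mulN1r oppr_le0.
    by apply: sumr_ge0 => x _; exact: sqr_ge0.
  - rewrite dot_mxvec_rank1 qY big_seq big1 // => w ws.
    by rewrite dotC sbs // expr0n.
  rewrite dotZl dot_mxvec_diag mulN1r lerN2 sumA.
  have -> : \sum_(i in A) Y i i = (size s)%:R.
    rewrite -(sum_sqnorm_orthonormal os) [LHS]big_mkcond; apply: eq_bigr => i _.
    by rewrite -Yd; case: ifPn => // /YA ->.
  by rewrite ler_pdivrMr // -natrM ler_nat mulnC.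
rewrite -(vec_mxK x) in xD xg; pose X := vec_mx x; exists X.
have Xle i k : X i k <= X k i.
  rewrite -subr_le0 -!dot_mxvec_delta -dotBl; apply: xD.
  by constructor 1; exists i, k.
have Xpsd w : 0 <= qform X w.
  rewrite -oppr_le0 -mulN1r -dot_mxvec_rank1 -dotZl; apply: xD.
  by constructor 2; exists w.
split=> //.
- by move=> i k; apply/eqP; rewrite eq_le !Xle.
- by move=> i; rewrite mxE; case/andP: (xbox (mxvec_index i i)).
- move=> b bbs; apply/eqP; rewrite eq_le Xpsd andbT -dot_mxvec_rank1.
  by apply: xD; constructor 3; exists b.
- split=> [|j]; last by rewrite -subr_le0 -gE.
  rewrite -lerN2 -sumA -mulN1r -dot_mxvec_diag -dotZl; apply: xD.
  by constructor 4.
Qed.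

(** Double counting of pairs of a big set and an alive element in it. Empty traces are excluded
    because for [t = 0] every set of [F] is big. *)
Lemma few_big_sets (F : {set {set 'I_n}}) (t : nat) (A : {set 'I_n}) :
  degree_le F t ->
  (6 * #|[set S in big_sets F t A | S :&: A != finset.set0]| <= #|A|)%N.
Proof.
move=> Ft; set B := [set S in _ | _].
have sumB : (\sum_(S in B) #|S :&: A| <= t * #|A|)%N.
  under eq_bigr do rewrite -sum1_card big_mkcond /=.
  rewrite exchange_big /= (bigID (mem A)) /= [X in (_ + X)%N]big1 ?addn0.
    rewrite mulnC -sum_nat_const; apply: leq_sum => i iA.
    rewrite -big_mkcondr sum1_card; apply: leq_trans (Ft i).
    apply: subset_leq_card; apply/fintype.subsetP => S; rewrite !inE.
    by rewrite unfold_in !inE => /andP[/andP[/andP[-> _] _] /andP[-> _]].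
  by move=> i iA; rewrite big1 // => S _; rewrite inE (negPf iA) andbF.
(* For [t = 0] nothing can be cancelled; the count itself then forces all traces to be empty. *)
case: t => [|t] in Ft B sumB *.
  suff -> : B = finset.set0 by rewrite cards0.
  apply/setP => S; rewrite [RHS]inE; apply/negP => SB.
  move: sumB; rewrite mul0n leqn0 sum_nat_eq0 => /forallP/(_ S).
  by rewrite SB cards_eq0 /=; move: SB; rewrite inE => /andP[_ /negPf ->].
have : (#|B| * (6 * t.+1) <= \sum_(S in B) #|S :&: A|)%N.
  rewrite -sum_nat_const; apply: leq_sum => S.
  by rewrite !inE => /andP[/andP[_]].
move=> /leq_trans/(_ sumB); rewrite mulnA mulnC leq_pmul2l // => h.
by rewrite mulnC.
Qed.

Lemma sdp_feasible_third (F : {set {set 'I_n}}) (t : nat) (A : {set 'I_n})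
    (x : 'rV[R]_n) :
  degree_le F t -> (forall i, i \in A -> `|x 0 i| <= 1) ->
  exists2 u, sdp_feasible F t A x u & #|A|%:R / 3 <= sdp_value A u.
Proof.
move=> Ft x1.
pose mask (S : {set 'I_n}) (c : 'I_n -> R) : 'rV[R]_n :=
  \row_i (if i \in S :&: A then c i else 0).
(* The boolean selects between the plain constraint and the one weighted by the coloring;
   [x i ^+ 2 <= 1] lets both share [e]. *)
pose v (j : {set 'I_n} * bool) := mask j.1 (if j.2 then x 0 else fun=> 1).
pose e (j : {set 'I_n} * bool) := mask j.1 (fun=> 1).
pose B := [set S in big_sets F t A | S :&: A != finset.set0].
pose bs := [seq mask Q (fun=> 1) | Q <- enum B].
have [||X [Xsym Xpsd X1 Xbs [XA Xj]]] := @psd_solution A _ v e bs.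
- case=> S b i; rewrite !mxE /=; case: ifP => [|_]; last by rewrite expr0n.
  rewrite inE => /andP[_ iA]; case: b => /=; last by rewrite expr1n.
  by rewrite -real_normK ?num_real // expr_le1 // x1.
- by rewrite size_map -cardE; exact: few_big_sets.
have [u uX] := psd_gram_vectors Xsym Xpsd.
have uS (S : {set 'I_n}) : \sum_(i in S :&: A) u i = \sum_(i in S :&: A) 1 *: u i.
  by apply: eq_bigr => i _; rewrite scale1r.
have eS S b : \sum_i e (S, b) 0 i * X i i = \sum_(i in S :&: A) sqnorm (u i).
  rewrite [RHS]big_mkcond; apply: eq_bigr => i _; rewrite mxE /= /sqnorm uX.
  by case: ifP; rewrite ?mul1r ?mul0r.
exists u; last by rewrite /sdp_value; under eq_bigr do rewrite /sqnorm uX.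
split.
- move=> S Sbig; rewrite uS (sqnorm_sum _ _ uX).
  (* A big set missing [A] is not in [bs], but its mask is zero. *)
  have [S0|SA] := eqVneq (S :&: A) finset.set0.
    suff z : mask S (fun=> 1) = 0 by rewrite -/(mask S _) z /qform dotC dot0l.
    by apply/rowP => i; rewrite !mxE S0 inE.
  by apply: Xbs; apply/mapP; exists S; rewrite // mem_enum inE Sbig.
- by move=> S _; rewrite uS (sqnorm_sum _ _ uX) -(eS S false); exact: Xj (S, false).
- by move=> S _; rewrite (sqnorm_sum _ _ uX) -(eS S true); exact: Xj (S, true).
- by move=> i _; rewrite /sqnorm uX.
Qed.

Lemma sdp_optimal_value (F : {set {set 'I_n}}) (t : nat) (A : {set 'I_n})
    (x : 'rV[R]_n) u :
  degree_le F t -> (forall i, i \in A -> `|x 0 i| <= 1) ->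
  sdp_optimal F t A x u -> #|A|%:R / 3 <= sdp_value A u.
Proof.
move=> Ft x1 [_ umax]; have [v vf] := sdp_feasible_third Ft x1.
by move/le_trans; apply; exact: umax.
Qed.

End SdpValue.

(** * First and second moments of random signs *)

Section RandomSigns.
Variables (R : realType) (n : nat).

Definition flip (j : 'I_n) (r : signs n) : signs n :=
  [ffun k => r k (+) (k == j)].

Lemma flipK j : involutive (flip j).
Proof. by move=> r; apply/ffunP => k; rewrite !ffunE addbK. Qed.

(** Flipping sign [j] is a bijection, so the sum equals its own opposite. *)
Lemma sum_signs_odd (j : 'I_n) (f : signs n -> R) :
  (forall r, f (flip j r) = - f r) -> \sum_r f r = 0.
Proof.
move=> fN; have : \sum_r f r = - \sum_r f r.
  rewrite {1}(reindex_inj (inv_inj (flipK j))) -sumrN.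
  by apply: eq_bigr => r _; rewrite fN.
lra.
Qed.

Lemma sign_vec_flip j k (r : signs n) :
  sign_vec R (flip j r) 0 k = (if k == j then -1 else 1) * sign_vec R r 0 k.
Proof.
rewrite !mxE ffunE; case: eqP => _; last by rewrite addbF mul1r.
by rewrite addbT signrN mulN1r.
Qed.

Lemma sum_sign_vec_mul j k :
  \sum_(r : signs n) sign_vec R r 0 j * sign_vec R r 0 k =
  if j == k then #|signs n|%:R else 0.
Proof.
case: eqP => [->|/eqP jk].
  under eq_bigr do rewrite mxE -expr2 sqrr_sign.
  by rewrite sumr_const.
apply: (sum_signs_odd (j := j)) => r.
by rewrite !sign_vec_flip eqxx eq_sym (negPf jk) mul1r mulN1r mulNr.
Qed.

Lemma sum_dot_signs (u : 'rV[R]_n) : \sum_(r : signs n) dot (sign_vec R r) u = 0.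
Proof.
rewrite exchange_big big1 // => j _; rewrite -mulr_suml (sum_signs_odd (j := j)).
  by rewrite mul0r.
by move=> r; rewrite sign_vec_flip eqxx mulN1r.
Qed.

Lemma sum_sqr_dot_signs (u : 'rV[R]_n) :
  \sum_(r : signs n) dot (sign_vec R r) u ^+ 2 = #|signs n|%:R * sqnorm u.
Proof.
under eq_bigr do rewrite expr2 {1}/dot mulr_suml.
rewrite exchange_big /= sqnormE mulr_sumr; apply: eq_bigr => j _.
under eq_bigr do rewrite /dot mulr_sumr.
rewrite exchange_big /= (bigD1 j) //= [X in _ + X]big1 ?addr0 => [|k kj].
  under eq_bigr do rewrite mulrACA -expr2.
  by rewrite -mulr_suml sum_sign_vec_mul eqxx.
under eq_bigr do rewrite mulrACA.
by rewrite -mulr_suml sum_sign_vec_mul eq_sym (negPf kj) mul0r.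
Qed.

Lemma dot_sign_le (r : signs n) (u : 'rV[R]_n) :
  sqnorm u <= 1 -> `|dot (sign_vec R r) u| <= n%:R.
Proof.
move=> u1; apply: le_trans (ler_norm_sum _ _ _) _.
apply: le_trans (_ : \sum_(i < n) 1 <= _); last by rewrite sumr_const card_ord.
apply: ler_sum => j _; rewrite normrM mxE normr_sign mul1r.
rewrite -(@expr_le1 _ 2) // real_normK ?num_real //; apply: le_trans u1.
by rewrite sqnormE (bigD1 j) //= lerDl sumr_ge0 // => k _; exact: sqr_ge0.
Qed.

End RandomSigns.

(** * Expected decay of the potential *)

Section Potential.
Variables (R : realType) (n : nat).

Definition potential (s : state R n) : R :=
  \sum_(i in alive s) (1 - coloring s 0 i ^+ 2).

(** A step moves a coordinate by at most [1 / n], so newly frozen variables satisfy [x ^+ 2 <= 1]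
    and dropping their terms only lowers the sum. The linear term averages to zero; the quadratic
    one gives the SDP value. *)
Lemma potential_step (s : state R n) (u : 'I_n -> 'rV[R]_n) :
  0 <= gamma R n -> gamma R n * n%:R <= n%:R^-1 ->
  (forall i, i \in alive s -> `|coloring s 0 i| <= 1 - n%:R^-1) ->
  (forall i, i \in alive s -> sqnorm (u i) <= 1) ->
  \sum_(r : signs n) potential (step s u r) <=
  #|signs n|%:R * (potential s - gamma R n ^+ 2 * sdp_value (alive s) u).
Proof.
move=> g0 gn xs us; set N := #|signs n|%:R.
apply: (@le_trans _ _ (\sum_(r : signs n)
  \sum_(i in alive s) (1 - next_coloring s u r 0 i ^+ 2))).
  apply: ler_sum => r _; rewrite /potential /= big_mkcond [leRHS]big_mkcond.
  apply: ler_sum => i _; rewrite finset.in_setD andbC; case: (boolP (i \in alive s)) => //= iA.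
  case: ifP => // _; rewrite subr_ge0 mxE iA -real_normK ?num_real // expr_le1 //.
  apply: le_trans (ler_normD _ _) _; rewrite normrM (ger0_norm g0).
  have h := xs i iA.
  have h2 : gamma R n * `|dot (sign_vec R r) (u i)| <= n%:R^-1.
    by apply: le_trans gn; rewrite ler_wpM2l // dot_sign_le // us.
  lra.
rewrite exchange_big /= /potential /sdp_value mulrBr !mulr_sumr -sumrB.
apply: ler_sum => i iA.
under eq_bigr do rewrite mxE iA.
set x := coloring s 0 i; set g := gamma R n.
have -> : \sum_(r : signs n) (1 - (x + g * dot (sign_vec R r) (u i)) ^+ 2) =
  \sum_(r : signs n) (1 - x ^+ 2) - 2 * x * g * \sum_r dot (sign_vec R r) (u i) -
  g ^+ 2 * \sum_(r : signs n) dot (sign_vec R r) (u i) ^+ 2.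
  rewrite !mulr_sumr -!sumrB; apply: eq_bigr => r _; ring.
rewrite sum_dot_signs sum_sqr_dot_signs sumr_const mulr0 subr0.
by rewrite (mulrCA N) -[X in X - _ <= _]mulr_natl.
Qed.

Lemma alive_lt (sol : solver R n) (h : seq (signs n)) i : (2 <= n)%N ->
  i \in alive (run sol h) -> `|coloring (run sol h) 0 i| < 1 - n%:R^-1.
Proof.
move=> n2; case: h => [_|r h] /=; last by rewrite !inE -ltNge => /andP[].
by rewrite mxE normr0 subr_gt0 invf_lt1 ?ltr1n // ltr0n; apply: leq_trans n2.
Qed.

(** Summing over the latest draw first plays the role of conditioning on the past. *)
Lemma sum_tuple_cons (T : finType) k (f : seq T -> R) :
  \sum_(h : k.+1.-tuple T) f h = \sum_(h : k.-tuple T) \sum_r f (r :: h).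
Proof.
rewrite pair_big (reindex (fun p : k.-tuple T * T => [tuple of p.2 :: p.1])) //=.
exists (fun h : k.+1.-tuple T => ([tuple of behead h], thead h)).
  by move=> [h r] _ /=; rewrite theadE; congr (_, _); apply: val_inj.
by move=> h _ /=; rewrite [RHS]tuple_eta; apply: val_inj.
Qed.

(** Stated for sums instead of averages, hence a factor [#|signs n|] per round. *)
Lemma potential_decay (F : {set {set 'I_n}}) (t : nat) (sol : solver R n) k :
  (2 <= n)%N -> 1 <= ln (n%:R : R) -> degree_le F t -> optimal_solver F t sol ->
  (k <= horizon R n)%N ->
  \sum_(h : k.-tuple (signs n)) potential (run sol h) <=
  (#|signs n|%:R * (1 - gamma R n ^+ 2 / 3)) ^+ k * n%:R.
Proof.
move=> n2 ln1 Ft opt.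
have n0 : 0 < n%:R :> R by rewrite ltr0n; apply: leq_trans n2.
have n1 : 1 <= n%:R :> R by rewrite ler1n; apply: leq_trans n2.
have g0 : 0 < gamma R n.
  by rewrite invr_gt0 mulr_gt0 ?exprn_gt0 // (lt_le_trans _ ln1).
have gn : gamma R n * n%:R <= n%:R^-1.
  have l0 : 0 < ln n%:R :> R by exact: lt_le_trans ln1.
  have -> : gamma R n * n%:R = n%:R^-1 / ln n%:R.
    by rewrite /gamma; field; rewrite !gt_eqF.
  by rewrite ler_piMr ?invr_ge0 ?(ltW n0) // invf_le1.
have g1 : gamma R n <= 1.
  apply: le_trans (_ : gamma R n * n%:R <= _); first by rewrite ler_peMr // ltW.
  by apply: le_trans gn _; rewrite invf_le1.
elim: k => [_|k IH kT].
  rewrite expr0 mul1r (_ : \sum_(h : _) _ = potential (init R n)).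
    rewrite /potential /=; under eq_bigr do rewrite mxE expr0n subr0.
    by rewrite sumr_const cardsT card_ord.
  rewrite (eq_bigr (fun=> potential (init R n))) => [|h _].
    by rewrite sumr_const card_tuple expn0.
  by rewrite (tuple0 h).
rewrite (@sum_tuple_cons _ _ (fun h => potential (run sol h))).
set c := #|signs n|%:R * (1 - gamma R n ^+ 2 / 3); rewrite exprS -mulrA.
apply: (@le_trans _ _ (\sum_(h : k.-tuple (signs n)) c * potential (run sol h))).
  apply: ler_sum => h _ /=.
  have opth : sdp_optimal F t (alive (run sol h)) (coloring (run sol h)) (sol h).
    by apply: opt; rewrite size_tuple.
  have xh i : i \in alive (run sol h) -> `|coloring (run sol h) 0 i| <= 1 - n%:R^-1.
    by move=> ih; rewrite ltW // alive_lt.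
  have [[_ _ _ uh] _] := opth.
  apply: le_trans (potential_step (ltW g0) gn xh uh) _.
  rewrite /c -mulrA ler_wpM2l // mulrBl mul1r lerB //.
  rewrite -mulrA ler_wpM2l ?sqr_ge0 //.
  have x1 i : i \in alive (run sol h) -> `|coloring (run sol h) 0 i| <= 1.
    by move=> /xh /le_trans; apply; rewrite lerBlDr lerDl invr_ge0 ltW.
  (* Each term of the potential is at most [1], so the potential is at most [#|A|]. *)
  apply: le_trans (sdp_optimal_value Ft x1 opth); rewrite mulrC ler_pM2r //.
  rewrite -sum1_card natr_sum; apply: ler_sum => i _.
  by rewrite lerBlDr lerDl sqr_ge0.
rewrite -mulr_sumr; apply: ler_wpM2l; last exact: IH (ltnW kT).
rewrite mulr_ge0 // subr_ge0 ler_pdivrMr // mul1r.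
apply: (@le_trans _ _ 1); last by rewrite ler1n.
by rewrite expr_le1 // ltW.
Qed.

(** Markov's inequality pointwise: [|x| < 1 - 1/n] gives [1 - x ^+ 2 >= 1/n], so a single alive
    variable suffices. *)
Lemma potential_ge (sol : solver R n) (h : seq (signs n)) : (2 <= n)%N ->
  (alive (run sol h) != finset.set0)%:R <= n%:R * potential (run sol h).
Proof.
move=> n2; have n0 : 0 < n%:R :> R by rewrite ltr0n; apply: leq_trans n2.
have term i : i \in alive (run sol h) ->
    n%:R^-1 <= 1 - coloring (run sol h) 0 i ^+ 2.
  move=> /(alive_lt n2); set x := coloring _ _ _ => xn.
  have v0 : 0 < n%:R^-1 :> R by rewrite invr_gt0.
  rewrite -[x ^+ 2]real_normK ?num_real //.
  have := normr_ge0 x; move: xn v0; move: (`|x|) (_^-1) => y z *; nra.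
have term0 i : i \in alive (run sol h) -> 0 <= 1 - coloring (run sol h) 0 i ^+ 2.
  by move=> /term; apply: le_trans; rewrite invr_ge0 ltW.
case: eqVneq => [_|/set0Pn[i ih]].
  by rewrite mulr_ge0 ?(ltW n0) // sumr_ge0.
rewrite -ler_pdivrMl // mulr1; apply: le_trans (term i ih) _.
rewrite /potential (bigD1 i) //= lerDl; apply: sumr_ge0 => k /andP[kh _].
exact: term0.
Qed.

End Potential.

(** * Decay over all rounds and the final probability bound *)

Lemma horizon_decay (R : realType) (n : nat) : 1 <= ln (n%:R : R) ->
  (1 - gamma R n ^+ 2 / 3) ^+ horizon R n <= expR 1 / n%:R ^+ 4.
Proof.
move=> ln1.
have n0 : 0 < n%:R :> R.
  by case: n ln1 => [|m _]; rewrite ?ltr0n // ln0 // ler10.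
have n1 : 1 <= n%:R :> R by rewrite ler1n -(ltr0n R).
set g := gamma R n; set T := horizon R n.
have g0 : 0 < g by rewrite invr_gt0 mulr_gt0 ?exprn_gt0 // (lt_le_trans _ ln1).
have g1 : g <= 1.
  rewrite invf_le1 ?mulr_gt0 ?exprn_gt0 ?(lt_le_trans _ ln1) //.
  by rewrite mulr_ege1 // exprn_ege1.
have g20 : 0 < g ^+ 2 by rewrite exprn_gt0.
have g21 : g ^+ 2 <= 1 by rewrite expr_le1 // ltW.
have b0 : 0 <= 1 - g ^+ 2 / 3 by lra.
apply: (@le_trans _ _ (expR (- (g ^+ 2 / 3)) ^+ T)).
  by rewrite lerXn2r ?nnegrE ?expR_ge0 // expR_ge1Dx.
rewrite -expRM_natl.
have -> : expR 1 / n%:R ^+ 4 = expR (1 - 4 * ln n%:R) :> R.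
  rewrite expRD expRN -[4]/(4%:R) expRM_natl lnK //.
rewrite ler_expR.
(* Truncation loses less than one round, hence less than [g ^+ 2 / 3 <= 1] in the exponent; the
   factor [expR 1] absorbs it. *)
have : 12 / g ^+ 2 * ln n%:R < T.+1%:R by rewrite /T /horizon truncnS_gt.
rewrite mulrAC ltr_pdivrMr // -[T.+1%:R]natr1.
move: (ln _) T%:R => L t; lra.
Qed.

Theorem theorem8 (R : realType) :
  exists C : R, forall (n t : nat) (F : {set {set 'I_n}}) (sol : solver R n),
    (2 <= n)%N -> degree_le F t -> optimal_solver F t sol ->
    1 - C / n%:R ^+ 2 <= prob_none_alive sol.
Proof.
(* The square serves the case [n < e], where the claimed lower bound is at most [0]; for larger [n]
   the argument yields [expR 1]. *)
exists (expR 1 ^+ 2) => n t F sol n2 Ft opt.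
have n0 : 0 < n%:R :> R by rewrite ltr0n; apply: leq_trans n2.
have e1 : 1 <= expR 1 :> R by rewrite -expR0 ler_expR.
rewrite /prob_none_alive /unif_prob; set T := horizon R n.
have [lnlt|ln1] := ltP (ln (n%:R : R)) 1.
  apply: (@le_trans _ _ 0); last by rewrite divr_ge0.
  rewrite subr_le0 ler_pdivlMr ?exprn_gt0 // mul1r lerXn2r ?nnegrE ?expR_ge0 //.
  by rewrite -[leLHS]lnK // ler_expR ltW.
set E := [set h | _]; set N := #|{: T.-tuple (signs n)}|.
have N0 : 0 < N%:R :> R.
  by rewrite ltr0n; apply/card_gt0P; exists (nseq_tuple T [ffun=> false]).
have -> : #|E|%:R / N%:R = 1 - #|~: E|%:R / N%:R :> R.
  apply/eqP; rewrite eq_sym subr_eq -mulrDl -natrD cardsC divff //.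
  by rewrite gt_eqF.
rewrite lerD2l lerN2 ler_pdivrMr //.
have -> : #|~: E|%:R = \sum_(h : T.-tuple (signs n))
    (alive (run sol h) != finset.set0)%:R :> R.
  rewrite -sum1_card natr_sum big_mkcond; apply: eq_bigr => h _.
  by rewrite !inE; case: (_ == _).
apply: (@le_trans _ _ (n%:R * \sum_(h : T.-tuple (signs n)) potential (run sol h))).
  by rewrite mulr_sumr; apply: ler_sum => h _; exact: potential_ge.
have := potential_decay n2 ln1 Ft opt (leqnn _).
have NE : N%:R = #|signs n|%:R ^+ T :> R by rewrite /N card_tuple natrX.
rewrite exprMn -/T -NE => dec.
apply: le_trans (ler_wpM2l (ltW n0) dec) _.
have hd := horizon_decay ln1; rewrite -/T in hd.
apply: (@le_trans _ _ (n%:R * (N%:R * (expR 1 / n%:R ^+ 4) * n%:R))).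
  by rewrite ler_pM2l // ler_pM2r // ler_pM2l.
have -> : n%:R * (N%:R * (expR 1 / n%:R ^+ 4) * n%:R) =
    N%:R * (expR 1 / n%:R ^+ 2) :> R by field; rewrite gt_eqF.
rewrite mulrC ler_pM2r // ler_pM2r ?invr_gt0 ?exprn_gt0 //.
by rewrite expr2 ler_peMr // expR_ge0.
Qed.
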